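(* Let $k = 2^t$ for some odd integer $t \geq 3$, let $m=\sqrt{2k}$, let $n$ be the smallest integer such that $n \equiv 0 \pmod{m}$ and $n > 2\sqrt{k(2k+1)}+\sqrt{2k}$, and let $L$ be a graph of order $n$ that is a vertex disjoint union of $\frac{n}{m}$ copies of $K_{m}$. Then a partial $k$-star decomposition of $K_n$ whose leave is $L$ exists, and furthermore it cannot be embedded in a $k$-star decomposition of $K_{n+s}$ for any nonnegative integer $s < 6k-n$.
   Context: All graphs are finite and simple. A $k$-star is a complete bipartite graph $K_{1,k}$. A $k$-star decomposition of a graph $G$ is a set of $k$-stars that are subgraphs of $G$ such that each edge of $G$ is in exactly one of the $k$-stars. A partial $k$-star decomposition of $G$ is a set of $k$-stars that are subgraphs of $G$ such that each edge of $G$ is in at most one of the $k$-stars; its leave is the graph with vertex set $V(G)$ whose edges are exactly the edges of $G$ that are in none of its $k$-stars. An embedding of a partial $k$-star decomposition $\mathcal{A}$ of a graph $G$ is a partial $k$-star decomposition $\mathcal{B}$ of a graph $H$ such that $\mathcal{A} \subseteq \mathcal{B}$ and $G$ is a subgraph of $H$; we then say $\mathcal{A}$ is embedded in $\mathcal{B}$. $K_m$ denotes the complete graph on $m$ vertices. *)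

(* Defs.v *)
From HB Require Import structures.
From mathcomp Require Import all_boot all_order all_algebra.
From mathcomp Require Import finmap.
Set Implicit Arguments.
Unset Strict Implicit.
Unset Printing Implicit Defensive.

Local Open Scope fset_scope.

(* The vertices of all graphs are drawn from one choiceType T (e.g. nat), so  *)
(* that "G is a subgraph of H" and inclusions between sets of subgraphs of    *)
(* different graphs are literal.  An edge is a two-element set of vertices.   *)
Definition wf_graph (T : choiceType) (p : {fset T} * {fset {fset T}}) : bool :=
  all (fun e : {fset T} => (e `<=` p.1) && (#|` e| == 2)) p.2.

Record graph (T : choiceType) : Type :=
  Graph { graph_val :> {fset T} * {fset {fset T}}; _ : wf_graph graph_val }.

HB.instance Definition _ (T : choiceType) := [isSub for @graph_val T].
HB.instance Definition _ (T : choiceType) := [Choice of graph T by <:].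

Section Graphs.
Variable T : choiceType.
Implicit Types (G H S : graph T) (A B C : {fset graph T}).

Definition vertices G : {fset T} := (graph_val G).1.
Definition edges G : {fset {fset T}} := (graph_val G).2.
Definition graph_order G : nat := #|` vertices G|.

Definition subgraph G H : Prop :=
  vertices G `<=` vertices H /\ edges G `<=` edges H.

Definition is_complete (n : nat) G : Prop :=
  graph_order G = n /\
  (forall x y : T, x \in vertices G -> y \in vertices G -> x != y ->
     [fset x; y] \in edges G).

Definition is_complete_bipartite (a b : nat) G : Prop :=
  exists X Y : {fset T},
    [/\ [disjoint X & Y], #|` X| = a, #|` Y| = b, vertices G = X `|` Y
      & edges G = [fset [fset x; y] | x in X, y in Y]].

Definition is_star (k : nat) G : Prop := is_complete_bipartite 1 k G.

Definition is_disjoint_union C G : Prop :=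
  [/\ forall K K' : graph T, K \in C -> K' \in C -> K != K' ->
        [disjoint vertices K & vertices K'],
      vertices G = \bigcup_(K <- C) vertices K
    & edges G = \bigcup_(K <- C) edges K].

Definition containing A (e : {fset T}) : {fset graph T} :=
  [fset S in A | e \in edges S].

Definition star_decomposition (k : nat) G A : Prop :=
  (forall S, S \in A -> is_star k S /\ subgraph S G) /\
  (forall e : {fset T}, e \in edges G -> #|` containing A e| = 1).

Definition partial_star_decomposition (k : nat) G A : Prop :=
  (forall S, S \in A -> is_star k S /\ subgraph S G) /\
  (forall e : {fset T}, e \in edges G -> #|` containing A e| <= 1).

Definition leave_val G A : {fset T} * {fset {fset T}} :=
  (vertices G, [fset e in edges G | containing A e == fset0]).

Fact leave_wf G A : wf_graph (leave_val G A).
Proof.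
apply/allP => e /=; rewrite !inE /= => /andP[eG _].
by have /allP /(_ _ eG) := valP G.
Qed.

Definition leave G A : graph T := Graph (leave_wf G A).

Definition is_embedding (k : nat) G A H B : Prop :=
  [/\ partial_star_decomposition k H B, A `<=` B & subgraph G H].

End Graphs.

Import GRing.Theory Num.Theory.
Local Open Scope ring_scope.

Definition order_condition (R : rcfType) (k m : nat) (j : int) : Prop :=
  (j = 0 %[mod m])%Z /\
  2 * Num.sqrt (k%:R * (2 * k%:R + 1)) + Num.sqrt (2 * k%:R) < j%:~R :> R.

(* Main.v *)
Require Import Defs.
From mathcomp Require Import all_boot all_order all_algebra.
From mathcomp Require Import finmap.
From mathcomp Require Import zify.

Set Implicit Arguments.
Unset Strict Implicit.
Unset Printing Implicit Defensive.

(** Write [n = q m] and [r = q - 1].  The hypotheses say [m ^ 2 = 2 k] and that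
    [r] is the least natural number with [r ^ 2 > 2 m ^ 2 + 2 = 4 k + 2]; hence
    [m <= r <= 2 m].

    Existence.  The complement of the leave is the complete [q]-partite graph
    with parts of size [m].  Grouping the arcs that leave each vertex into
    blocks of size [k] turns an orientation with all outdegrees divisible by [k]
    into a [k]-star decomposition ([stars_of_orientation]), so it is enough to
    find such an orientation.  In each part, [2 m - r] vertices get outdegree
    [k] and the other [r - m] get outdegree [2 k], which gives the right total.
    By Hakimi's theorem ([orientation_with_outdeg]) these outdegrees are
    realisable when every vertex set spans at most as many edges as its
    prescribed outdegrees add up to.  If the set meets the parts in
    [s_1, ..., s_q] vertices, it spans
    [\sum_(i < j) s_i s_j <= r / 2 * \sum_i s_i ^ 2] edges, and already inside
    each single part the prescribed outdegrees are at least [r / 2 * s_i ^ 2]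
    ([part_weight_ge]).

    Non-embeddability.  Suppose that [B] contains [A] and decomposes the
    complete graph on [N = n + s < 6 k] vertices.  Call a vertex bare when no
    star of [B] outside [A] is centred at it.  Two bare vertices cannot be
    joined by an edge outside the stars of [A]; so either there is at most one
    bare vertex, or they all lie in distinct cliques of the leave.  There are thus at
    most [q] of them, and [|B| >= |A| + N - q] ([embedding_card]).  Since
    [|A| = q (q - 1)], this lower bound is [r ^ 2 - 1 + N >= 4 k + 2 + N].  But
    [k |B| = N (N - 1) / 2] and [k] is a power of two, so [N] is [2 k c] or
    [2 k c + 1] with [c <= 2], and then [|B|] is too small
    ([too_many_stars]). *)

(** * Orientations with prescribed outdegrees *)

Section Orientations.
Variable V : finType.
Implicit Types (e o : rel V) (f : V -> nat) (A : {set V}).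

(** Comparing numbers rather than booleans makes each edge carry exactly one
    arc, forces [e] to be symmetric and loopless, and lets sums over [e] be
    rewritten as sums over [o]. *)
Definition orients o e := forall x y, o x y + o y x = e x y :> nat.

Definition outdeg o x := \sum_y (o x y : nat).

Lemma orientsW o e x y : orients o e -> o x y -> e x y.
Proof. by move=> /(_ x y) oe oxy; move: oe; rewrite oxy; case: (e x y). Qed.

Lemma orients_asym o e x y : orients o e -> o x y -> o y x = false.
Proof.
by move=> /(_ x y) oe oxy; move: oe; rewrite oxy; case: (e x y); case: (o y x).
Qed.

Definition rank_orientation e : rel V :=
  fun x y => e x y && (enum_rank x < enum_rank y).

Lemma rank_orientationP e :
  symmetric e -> irreflexive e -> orients (rank_orientation e) e.
Proof.
move=> e_sym e_irr x y; rewrite /rank_orientation (e_sym y x).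
case exy: (e x y) => //=.
have : x != y by apply: contraTneq exy => ->; rewrite e_irr.
rewrite -(inj_eq enum_rank_inj) -val_eqE /= neq_ltn.
by case: ltngtP.
Qed.

(** Both orders of the endpoints of an edge are counted on the left. *)
Lemma sum_orientation o e A : orients o e ->
  \sum_(x in A) \sum_(y in A) (e x y : nat)
  = (\sum_(x in A) \sum_(y in A) (o x y : nat)).*2.
Proof.
move=> oe.
under eq_bigr => x _ do (under eq_bigr => y _ do rewrite -oe; rewrite big_split).
by rewrite big_split /= [X in _ + X]exchange_big addnn.
Qed.

Lemma sum_outdeg o e : orients o e ->
  \sum_x \sum_y (e x y : nat) = (\sum_x outdeg o x).*2.
Proof.
move=> oe; have := sum_orientation setT oe.
under eq_bigr do under eq_bigl do rewrite inE.
under eq_bigl do rewrite inE.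
under [in X in _ = X -> _]eq_bigr do under eq_bigl do rewrite inE.
by under [in X in _ = X -> _]eq_bigl do rewrite inE.
Qed.

(** The last clause lets the rest of a path starting with the arc from [u] to
    [w] survive the reversal, provided that it avoids [u]. *)
Lemma reverse_edge o e u w : orients o e -> o u w ->
  exists o', [/\ orients o' e,
    forall x, outdeg o' x + (x == u) = outdeg o x + (x == w)
    & forall x y, x != u -> y != u -> o' x y = o x y].
Proof.
move=> oe ouw; have owu := orients_asym oe ouw.
have uNw : u == w = false.
  apply: contraTF ouw => /eqP<-; apply/negP=> ouu.
  by have := orients_asym oe ouu; rewrite ouu.
have wNu : w == u = false by rewrite eq_sym.
pose o' : rel V := fun x y => if (x == u) && (y == w) then false
  else if (x == w) && (y == u) then true else o x y.
exists o'; split.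
- move=> x y; have := oe x y; rewrite /o'.
  have [->|xu] := eqVneq x u; have [->|yw] := eqVneq y w;
    rewrite ?uNw ?wNu ?eqxx ?andbF ?andbT //=; rewrite ?ouw ?owu //.
  by have [->|] := eqVneq x w; have [->|] := eqVneq y u; rewrite /= ?ouw ?owu.
- move=> x; rewrite /outdeg.
  rewrite (bigD1 w) // (bigD1 u) ?uNw //=.
  rewrite [in RHS](bigD1 w) // [in RHS](bigD1 u) ?uNw //=.
  rewrite (eq_bigr (fun y => (o x y : nat))); last first.
    by move=> y /andP[yw yu]; rewrite /o' (negbTE yw) (negbTE yu) !andbF.
  rewrite /o' !eqxx uNw wNu !(andbT, andbF).
  have [->|xu] := eqVneq x u; first by rewrite uNw ouw /=; lia.
  by have [->|xw] := eqVneq x w; rewrite ?owu /=; lia.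
- by move=> x y xu yu; rewrite /o' (negbTE xu) (negbTE yu) andbF.
Qed.

(** Reversing a path moves one unit of outdegree from its first vertex to its
    last one, since inner vertices lose one arc and gain one. *)
Lemma reverse_path o e u p : orients o e -> path o u p -> uniq (u :: p) ->
  exists o', orients o' e /\
    forall x, outdeg o' x + (x == u) = outdeg o x + (x == last u p).
Proof.
move=> + + +; elim: p o u => [|w p IHp] o u oe /=; first by exists o.
move=> /andP[ouw wp] /andP[uNp wp_uniq].
have [o1 [o1e deg1 o1E]] := reverse_edge oe ouw.
have wp1 : path o1 w p.
  have /sub_in_path : {in [pred x | x != u] &, subrel o o1}.
    by move=> x y xu yu; rewrite o1E.
  apply=> //; apply/allP => x xp.
  by apply: contraNneq uNp => <-.
have [o2 [o2e deg2]] := IHp _ _ o1e wp1 wp_uniq.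
exists o2; split=> // x; have := deg1 x; have := deg2 x; lia.
Qed.

(** Hakimi's theorem.  As long as some vertex [u] has too large an outdegree,
    some vertex reachable from [u] has too small an outdegree: otherwise the set
    of vertices reachable from [u], which no arc leaves, would span more edges
    than its prescribed outdegrees allow.  Reversing a path between the two
    lowers the total deficiency. *)
Lemma orientation_with_outdeg e f :
  symmetric e -> irreflexive e ->
  (forall A, \sum_(x in A) \sum_(y in A) (e x y : nat)
             <= (\sum_(x in A) f x).*2) ->
  \sum_x \sum_y (e x y : nat) = (\sum_x f x).*2 ->
  exists o, orients o e /\ outdeg o =1 f.
Proof.
move=> e_sym e_irr hall total.
pose defect o := \sum_x (f x - outdeg o x).
have: forall d o, orients o e -> defect o = d ->
  exists o, orients o e /\ outdeg o =1 f; last first.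
  by move/(_ _ _ (rank_orientationP e_sym e_irr) erefl).
elim/ltn_ind=> d IHd o oe def_d.
have sum_eq : \sum_x outdeg o x = \sum_x f x.
  by apply: double_inj; rewrite -total (sum_outdeg oe).
case: (pickP (fun u => f u < outdeg o u)) => [u u_over|no_over]; last first.
  exists o; split=> // x.
  have le_f y : outdeg o y <= f y by rewrite leqNgt no_over.
  move: sum_eq; rewrite (bigD1 x) //= [RHS](bigD1 x) //= => sum_eq.
  have := le_f x.
  have : \sum_(i | i != x) outdeg o i <= \sum_(i | i != x) f i.
    by apply: leq_sum.
  by lia.
pose R := [set x | connect o u x].
have uR : u \in R by rewrite inE connect0.
case: (pickP (fun v => (v \in R) && (outdeg o v < f v)))
  => [v0|no_under]; last first.
  (* No arc leaves [R], so the outdegrees in [R] count the edges inside [R]. *)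
  have := hall R; rewrite (sum_orientation R oe) leq_double leqNgt => /negP[].
  have -> : \sum_(x in R) \sum_(y in R) (o x y : nat)
            = \sum_(x in R) outdeg o x.
    apply: eq_bigr => x; rewrite inE => ux; rewrite big_mkcond /=.
    apply: eq_bigr => y _; case: ifPn => //; rewrite inE.
    by case oxy: (o x y) => //; rewrite (connect_trans ux) ?connect1.
  rewrite (bigD1 u) //= [X in _ < X](bigD1 u) //= -addSn leq_add //.
  apply: leq_sum => x /andP[xR _].
  by have := no_under x; rewrite xR /= ltnNge => /negbFE.
move=> /andP[]; rewrite inE => /connectP[p0 /shortenP[p op p_uniq _] -> v_under].
have [o' [o'e deg']] := reverse_path oe op p_uniq.
apply: (IHd _ _ _ o'e erefl); rewrite -def_d /defect.
set v := last u p in v_under deg' *.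
rewrite (bigD1 v) //= [X in _ < X](bigD1 v) //= -addSn leq_add //.
  have := deg' v; rewrite eqxx; have [vu|_] := eqVneq v u; last by lia.
  by move: v_under; rewrite vu; lia.
apply: leq_sum => x xv; have := deg' x; rewrite (negbTE xv).
by have [->|] := eqVneq x u; lia.
Qed.

End Orientations.
(** * Complete multipartite graphs *)

Section CompleteMultipartite.
Variables q m : nat.
Implicit Types A : {set 'I_q * 'I_m}.

Definition multipartite : rel ('I_q * 'I_m) := fun x y => x.1 != y.1.

Let part_size A i := \sum_(j < m) ((i, j) \in A : nat).

Lemma sum_by_part A (F : 'I_q * 'I_m -> nat) :
  \sum_(x in A) F x = \sum_i \sum_j ((i, j) \in A : nat) * F (i, j).
Proof.
rewrite pair_bigA big_mkcond /=; apply: eq_bigr => -[i j] _ /=.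
by case: ifP => _; rewrite ?mul1n.
Qed.

Lemma inner_multipartite A :
  \sum_(x in A) \sum_(y in A) (multipartite x y : nat)
  = \sum_i \sum_(j | j != i) part_size A i * part_size A j.
Proof.
rewrite sum_by_part; apply: eq_bigr => i _.
have inner a : \sum_(y in A) (multipartite (i, a) y : nat)
               = \sum_(j | j != i) part_size A j.
  rewrite sum_by_part [RHS]big_mkcond; apply: eq_bigr => j _ /=.
  rewrite /multipartite /= eq_sym; case: ifP => _; last first.
    by rewrite big1 // => b _; rewrite muln0.
  by apply: eq_bigr => b _; rewrite muln1.
under eq_bigr do rewrite inner.
by rewrite -big_distrl big_distrr.
Qed.

(** Each product [s_i s_j] is at most the mean of [s_i ^ 2] and [s_j ^ 2], and
    each [s_i ^ 2] occurs for [q - 1] values of [j]. *)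
Lemma inner_multipartite_le A :
  \sum_(x in A) \sum_(y in A) (multipartite x y : nat)
  <= q.-1 * \sum_i part_size A i ^ 2.
Proof.
set s := part_size A; rewrite inner_multipartite -/s.
have others (c : nat) (i : 'I_q) : \sum_(j | j != i) c = q.-1 * c.
  rewrite sum_nat_const; congr (_ * _).
  by rewrite (cardC1 i) card_ord.
have sqr : \sum_(i < q) \sum_(j | j != i) s i ^ 2 = q.-1 * \sum_i s i ^ 2.
  by rewrite big_distrr; apply: eq_bigr => i _; rewrite others.
have sqr' : \sum_(i < q) \sum_(j | j != i) s j ^ 2 = q.-1 * \sum_i s i ^ 2.
  rewrite -sqr (exchange_big_dep predT) //=.
  by apply: eq_bigr => i _; apply: eq_bigl => j; rewrite eq_sym.
rewrite -leq_double -addnn -[X in _ <= X]addnn -{1}sqr -sqr' -!big_split /=.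
apply: leq_sum => i _; rewrite -!big_split /=; apply: leq_sum => j _.
by rewrite addnn -mul2n nat_Cauchy.
Qed.

Lemma sum_ord_lt c : c <= m -> \sum_(j < m) (j < c : nat) = c.
Proof.
move=> cm; rewrite -big_mkcond -(big_ord_widen m (fun=> 1) cm).
by rewrite sum1_card card_ord.
Qed.

Variables (k a : nat).
Hypotheses (m2 : m ^ 2 = 2 * k) (am : a <= m) (q1 : q.-1 = m + a).

(** The number [a] of vertices of outdegree [2 k] in each part is what makes the
    total outdegree equal to the number of edges. *)
Definition two_star_weights (x : 'I_q * 'I_m) : nat :=
  if x.2 < m - a then k else 2 * k.

(** The condition of Hakimi's theorem, one part at a time.  With [l] vertices of
    outdegree [k] and [h] of outdegree [2 k], where [l <= b = m - a] and
    [h <= a], it reads [(m + a) (l + h) ^ 2 <= m ^ 2 (l + 2 h)].  Bounding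
    [l ^ 2] by [b l] and [h ^ 2] by [a h] leaves an inequality between
    multiples of [l], [h] and [l h], which follows from [l h <= a l] and
    [l h <= b h]. *)
Lemma part_weight_ge A i :
  (m + a) * part_size A i ^ 2
  <= (\sum_j ((i, j) \in A : nat) * two_star_weights (i, j)).*2.
Proof.
pose l := \sum_(j < m) ((i, j) \in A) * (j < m - a).
pose h := \sum_(j < m) ((i, j) \in A) * ~~ (j < m - a).
have l_le : l <= m - a.
  rewrite -[m - a]sum_ord_lt ?leq_subr //; apply: leq_sum => j _.
  by rewrite -[X in _ <= X]mul1n leq_mul2r leq_b1 orbT.
have h_le : h <= a.
  have -> : a = \sum_(j < m) (~~ (j < m - a) : nat).
    have := sum_ord_lt (leq_subr a m).
    have : \sum_(j < m) ((j < m - a : nat) + ~~ (j < m - a)) = m.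
      under eq_bigr do rewrite addnC addn_negb.
      by rewrite sum1_card card_ord.
    by rewrite big_split /=; move: am; lia.
  apply: leq_sum => j _.
  by rewrite -[X in _ <= X]mul1n leq_mul2r leq_b1 orbT.
have -> : part_size A i = l + h.
  rewrite -big_split; apply: eq_bigr => j _ /=.
  by case: (_ \in A); case: (_ < _).
have -> : \sum_j ((i, j) \in A : nat) * two_star_weights (i, j)
          = k * l + 2 * k * h.
  rewrite !big_distrr -big_split; apply: eq_bigr => j _ /=.
  by rewrite /two_star_weights /=; case: (_ \in A); case: (_ < _);
    rewrite ?(mul1n, mul0n, muln1, muln0, addn0).
have -> : (k * l + 2 * k * h).*2 = m ^ 2 * (l + 2 * h) by rewrite m2; lia.
have [b def_m] : exists b, m = a + b by exists (m - a); lia.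
have {}l_le : l <= b by lia.
rewrite def_m.
have ah : h * (a * l) <= a * (a * l) by rewrite leq_mul2r h_le orbT.
have bl : l * ((2 * m + a) * h) <= b * ((2 * m + a) * h).
  by rewrite leq_mul2r l_le orbT.
have l2 : l * l <= b * l by rewrite leq_mul2r l_le orbT.
have h2 : h * h <= a * h by rewrite leq_mul2r h_le orbT.
rewrite def_m in bl.
have : (a + b + a) * (l * l + h * h) <= (a + b + a) * (b * l + a * h).
  by rewrite leq_mul2l leq_add ?orbT.
rewrite -!mulnn; lia.
Qed.

Lemma total_weight :
  (\sum_x two_star_weights x).*2
  = \sum_x \sum_y (multipartite x y : nat).
Proof.
have -> : \sum_x \sum_y (multipartite x y : nat) = q * (q.-1 * m ^ 2).
  have := inner_multipartite setT.
  under eq_bigr do under eq_bigl do rewrite inE.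
  under eq_bigl do rewrite inE.
  move=> ->.
  have sizeT i : part_size setT i = m.
    rewrite /part_size (eq_bigr (fun=> 1)) ?sum1_card ?card_ord // => j _.
    by rewrite inE.
  rewrite (eq_bigr (fun=> q.-1 * m ^ 2)) ?sum_nat_const ?card_ord // => i _.
  rewrite (eq_bigr (fun=> m ^ 2)) => [|j _]; last by rewrite !sizeT mulnn.
  by rewrite sum_nat_const cardC1 card_ord.
have -> : \sum_x two_star_weights x = q * (k * (m + a)).
  rewrite (eq_bigr (fun p : 'I_q * 'I_m => two_star_weights (p.1, p.2)));
    last by case.
  rewrite -(pair_bigA _ (fun i j => two_star_weights (i, j))) /=.
  rewrite (eq_bigr (fun=> k * (m + a))) ?sum_nat_const ?card_ord // => i _.
  have -> : k * (m + a) = 2 * k * m - k * (m - a).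
    by move: am => /subnK {1 2}<-; lia.
  rewrite -[X in 2 * k * X](card_ord m) -sum1_card.
  rewrite -[X in _ - k * X]sum_ord_lt ?leq_subr //.
  rewrite !big_distrr /= -sumnB => [|j _]; last by case: (_ < _); lia.
  by apply: eq_bigr => j _; rewrite /two_star_weights /=; case: (_ < _); lia.
by rewrite q1 m2; lia.
Qed.

Lemma multipartite_orientation :
  exists o, orients o multipartite /\ outdeg o =1 two_star_weights.
Proof.
apply: orientation_with_outdeg.
- by move=> x y; rewrite /multipartite eq_sym.
- by move=> x; rewrite /multipartite eqxx.
- move=> A; apply: (leq_trans (inner_multipartite_le A)).
  rewrite sum_by_part -mul2n !big_distrr /=; apply: leq_sum => i _.
  by rewrite mul2n q1 part_weight_ge.
- by rewrite total_weight.
Qed.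

End CompleteMultipartite.
(** * From orientations to star decompositions *)

Section StarsOfOrientations.
Local Open Scope fset_scope.

(** A set whose size is a multiple of [k] splits into blocks of size [k]; a
    labelling, unlike a family of blocks, needs no disjointness condition. *)
Lemma block_labelling (W : finType) (k : nat) (D : {set W}) : k %| #|D| ->
  exists b : W -> nat, forall y, y \in D -> #|[set z in D | b z == b y]| = k.
Proof.
case/dvdnP=> c; elim: c D => [|c IHc] D cardD.
  by exists (fun=> 0) => y; rewrite (cards0_eq cardD) inE.
pose D' := [set x in take k (enum D)].
have cardD' : #|D'| = k.
  rewrite cardsE; move/card_uniqP: (take_uniq k (enum_uniq D)) => ->.
  by rewrite size_takel // -cardE cardD leq_pmull.
have sD'D : D' \subset D.
  by apply/subsetP => x; rewrite inE => /mem_take; rewrite mem_enum.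
have [|b bP] := IHc (D :\: D').
  by rewrite cardsD (setIidPr sD'D) cardD cardD' mulSn addKn.
exists (fun z => if z \in D' then 0 else (b z).+1) => y yD.
have [yD'|yND'] := boolP (y \in D').
  rewrite -[RHS]cardD'; apply: eq_card => z; rewrite inE.
  by case: ifP => [/(subsetP sD'D)->|]; rewrite ?andbF.
rewrite -[RHS](bP y); last by rewrite inE yND'.
apply: eq_card => z; rewrite !inE.
by case: ifP => _ /=; rewrite ?andbF.
Qed.

Variable T : choiceType.

(** Removing [c] from the leaves makes the pair a graph for all [c] and [X]. *)
Fact star_wf (c : T) (X : {fset T}) :
  wf_graph (c |` X, [fset [fset c; x] | x in X `\ c]).
Proof.
apply/allP => e /imfsetP[x /= ]; rewrite !inE => /andP[xc xX] ->.
rewrite cardfs2 (eq_sym c) xc andbT; apply/fsubsetP => y.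
by rewrite !inE => /orP[]/eqP->; rewrite ?eqxx ?xX ?orbT.
Qed.

Definition star_graph c X := Graph (star_wf c X).

Lemma star_graphP k (c : T) (X : {fset T}) :
  c \notin X -> #|` X| = k -> is_star k (star_graph c X).
Proof.
move=> cX cardX; exists [fset c], X; split=> //.
- by apply/fdisjointP => x /fset1P->.
- by rewrite cardfs1.
- rewrite /edges /=.
  have -> : X `\ c = X by apply/fsetDidPl; rewrite fdisjointX1.
  apply/fsetP => e.
  apply/imfsetP/imfset2P => [[x /= xX ->]|[c' /fset1P -> [x /= xX ->]]].
    by exists c; rewrite ?inE //; exists x.
  by exists x.
Qed.

Lemma fset2_eq (a b c d : T) : [fset a; b] = [fset c; d] ->
  (a = c /\ b = d) \/ (a = d /\ b = c).
Proof.
move=> E.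
have : a \in [fset c; d] by rewrite -E !inE eqxx.
have : b \in [fset c; d] by rewrite -E !inE eqxx orbT.
have : c \in [fset a; b] by rewrite E !inE eqxx.
have : d \in [fset a; b] by rewrite E !inE eqxx orbT.
rewrite !inE.
by move=> /orP[]/eqP ? /orP[]/eqP ? /orP[]/eqP ? /orP[]/eqP ?; subst; auto.
Qed.

Variables (W : finType) (phi : W -> T).
Hypothesis phi_inj : injective phi.

(** The vertices are transported along an injection [phi], so that orientations
    may be built on a convenient finite type. *)
Lemma stars_of_orientation (o e : rel W) k (G : graph T) :
  0 < k -> orients o e -> (forall x, k %| outdeg o x) ->
  (forall x, phi x \in vertices G) ->
  (forall x y, e x y -> [fset phi x; phi y] \in edges G) ->
  exists A : {fset graph T},
    (forall S, S \in A -> is_star k S /\ subgraph S G) /\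
    (forall x y, #|` containing A [fset phi x; phi y]| = e x y).
Proof.
move=> k_gt0 oe k_dvd phiV phiE.
have [b bP] : exists b : W -> W -> nat, forall x y, o x y ->
    #|[set z | o x z && (b x z == b x y)]| = k.
  apply: (@fin_all_exists _ _ (fun x (b : W -> nat) => forall y, o x y ->
    #|[set z | o x z && (b z == b y)]| = k)) => x.
  have [|b bP] := @block_labelling W k [set y | o x y].
    by rewrite -sum1dep_card big_mkcond; apply: k_dvd.
  exists b => y oxy; rewrite -[RHS](bP y); last by rewrite inE.
  by apply: eq_card => z; rewrite !inE.
(* Indexing the stars by arcs, each arc naming the block that contains its head,
   avoids counting the blocks at each vertex. *)
pose leaves x y := [fset phi z | z in [set z | o x z && (b x z == b x y)]].
have leavesP x y v : reflect (exists z, [/\ o x z, b x z = b x y & v = phi z])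
    (v \in leaves x y).
  apply: (iffP (imfsetP _ _ _ _)) => [[z /=]|[z [oxz bz ->]]].
    by rewrite inE => /andP[oxz /eqP bz] ->; exists z.
  by exists z; rewrite //= inE oxz bz eqxx.
have o_irr x : o x x = false.
  by apply/negP => oxx; have := orients_asym oe oxx; rewrite oxx.
have center_notin x y : phi x \notin leaves x y.
  by apply/leavesP => -[z [oxz _ /phi_inj xz]]; rewrite -xz o_irr in oxz.
pose star x y := star_graph (phi x) (leaves x y).
have starE x y e0 :
    reflect (exists z, [/\ o x z, b x z = b x y & e0 = [fset phi x; phi z]])
            (e0 \in edges (star x y)).
  rewrite /star /edges /=.
  apply: (iffP (imfsetP _ _ _ _)) => [[v /=]|[z [oxz bz ->]]].
    by rewrite inE => /andP[_ /leavesP[z [oxz bz ->]]] ->; exists z.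
  have zl : phi z \in leaves x y by apply/leavesP; exists z.
  exists (phi z) => //=; rewrite inE zl andbT inE.
  by apply: contraNneq (center_notin x y) => <-.
pose A := [fset star p.1 p.2 | p in [set p : W * W | o p.1 p.2]].
have AP S : reflect (exists x y, o x y /\ S = star x y) (S \in A).
  apply: (iffP (imfsetP _ _ _ _)) => [[[x y] /=]|[x [y [oxy ->]]]].
    by rewrite inE => oxy ->; exists x, y.
  by exists (x, y); rewrite //= inE.
have containing_arc x y : o x y -> containing A [fset phi x; phi y] = [fset star x y].
  move=> oxy; apply/fsetP => S; rewrite !inE; apply/andP/eqP => [[]|->].
    move=> /AP[x' [y' [ox'y' ->]]] /starE[z [ox'z bz E]].
    have [[/phi_inj xx' /phi_inj yz]|[/phi_inj xz /phi_inj yx']] := fset2_eq E.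
      by subst; rewrite /star /leaves bz.
    by subst; rewrite (orients_asym oe oxy) in ox'z.
  by split; [apply/AP; by exists x, y | apply/starE; by exists y].
exists A; split=> [S /AP[x [y [oxy ->]]]|x y].
  split.
    apply: star_graphP; rewrite ?center_notin // card_imfset //= -(bP x y oxy).
    by rewrite cardE.
  split; apply/fsubsetP => v.
    by rewrite /star /vertices /= !inE => /orP[/eqP->|/leavesP[z [_ _ ->]]].
  by move=> /starE[z [oxz _ ->]]; apply: phiE; apply: orientsW oxz.
have := oe x y; case oxy: (o x y).
  by rewrite containing_arc // cardfs1 (orients_asym oe oxy) => <-.
case oyx: (o y x) => <-.
  by rewrite fsetUC containing_arc // cardfs1.
apply/eqP; rewrite cardfs_eq0; apply/eqP/fsetP => S; rewrite !inE.
apply/negP => /andP[/AP[x' [y' [_ ->]]] /starE[z [ox'z _ E]]].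
have [[/phi_inj ? /phi_inj ?]|[/phi_inj ? /phi_inj ?]] := fset2_eq E; subst.
  by rewrite oxy in ox'z.
by rewrite oyx in ox'z.
Qed.

End StarsOfOrientations.
(** * Counting stars *)

Section StarCounting.
Local Open Scope fset_scope.
Variable T : choiceType.
Implicit Types (G H K L S : graph T) (A B C : {fset graph T}) (e : {fset T}).

Lemma edge_sub G e : e \in edges G -> e `<=` vertices G.
Proof. by move=> eG; have /allP /(_ _ eG) /andP[] := valP G. Qed.

Lemma card_edge G e : e \in edges G -> #|` e| = 2.
Proof. by move=> eG; have /allP /(_ _ eG) /andP[_ /eqP] := valP G. Qed.

Lemma edgeP G e : e \in edges G ->
  exists x y, [/\ x \in vertices G, y \in vertices G, x != y & e = [fset x; y]].
Proof.
move=> eG; have [e0|/fset0Pn[x xe]] := eqVneq e fset0.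
  by have := card_edge eG; rewrite e0 cardfs0.
have /cardfs1P[y def_y] : #|` e `\ x| == 1.
  by move: (card_edge eG); rewrite (cardfsD1 x) xe add1n => -[->].
have def_e : e = [fset x; y] by rewrite -(fsetD1K xe) def_y.
have xy : x != y by have := fset11 y; rewrite -def_y !inE eq_sym => /andP[].
have /fsubsetP sub := edge_sub eG.
by exists x, y; split; rewrite // sub // def_e !inE eqxx ?orbT.
Qed.

Lemma card_complete n K : is_complete n K -> #|` edges K| = 'C(n, 2).
Proof.
move=> [<- Kcomp]; pose V := vertices K.
pose pairs := [set Y : {set V} | #|Y| == 2].
have -> : edges K = [fset [fsetval y in Y : {set V}] | Y in pairs].
  apply/fsetP => e; apply/idP/imfsetP => [/edgeP[x [y [xV yV xy ->]]]|[Y /=]].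
    exists [set [` xV]; [` yV]]; first by rewrite /= inE cards2 -val_eqE /= xy.
    apply/fsetP => z; rewrite !inE /=; apply/idP/in_fset_valP => /=.
      by move=> /orP[]/eqP->; [exists xV | exists yV];
        rewrite !inE -!val_eqE /= eqxx ?orbT.
    by move=> [zV]; rewrite !inE -!val_eqE.
  rewrite inE => /cards2P[x [y [xy ->]]] ->.
  suff -> : [fsetval z in [set x; y] : {set V}] = [fset val x; val y].
    by apply: Kcomp; rewrite ?(valP x) ?(valP y) // val_eqE.
  apply/fsetP => z; rewrite !inE /=; apply/in_fset_valP/idP => /=.
    by move=> [zV]; rewrite !inE -!val_eqE.
  move=> /orP[]/eqP->; [exists (valP x) | exists (valP y)];
    by rewrite !inE -!val_eqE /= eqxx ?orbT.
rewrite card_imfset /=; first by rewrite -cardE card_draws /graph_order cardfE.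
by move=> X Y /fsetP eqXY; apply/setP => x; have := eqXY (val x); rewrite !inE.
Qed.

Lemma star_hub k S : is_star k S ->
  #|` edges S| = k /\
  exists2 c, c \in vertices S & forall e, e \in edges S -> c \in e.
Proof.
move=> [X [Y [XY /eqP/cardfs1P[c def_X] cardY vS eS]]]; subst X.
have cY : c \notin Y by move/fdisjointP: XY; apply; rewrite inE.
have {}eS : edges S = [fset [fset c; y] | y in Y].
  rewrite eS; apply/fsetP => e.
  apply/imfset2P/imfsetP => [[c' /fset1P -> [x /= xX ->]]|[x /= xX ->]].
    by exists x.
  by exists c; rewrite ?inE //; exists x.
split; last first.
  exists c; first by rewrite vS !inE eqxx.
  by move=> e; rewrite eS => /imfsetP[y _ ->]; rewrite !inE eqxx.
rewrite eS -cardY; apply: card_in_imfset => x y /= xY yY E.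
by have [[]|[cy]] := fset2_eq E => //; rewrite cy yY in cY.
Qed.

Lemma sum_card_edges (A : {fset graph T}) (E : {fset {fset T}}) :
  (forall S, S \in A -> edges S `<=` E) ->
  \sum_(S <- A) #|` edges S| = \sum_(e <- E) #|` containing A e|.
Proof.
move=> sub.
have -> : \sum_(S <- A) #|` edges S|
          = \sum_(S <- A) \sum_(e <- E) (e \in edges S : nat).
  rewrite big_seq [RHS]big_seq; apply: eq_bigr => S SA.
  have {1}-> : edges S = [fset e in E | e \in edges S].
    apply/fsetP => e; rewrite !inE /=; apply/idP/andP => [eS|[]//].
    by rewrite eS (fsubsetP (sub _ SA)).
  by rewrite card_fset_sum1 big_fset /= [LHS]big_mkcond.
rewrite exchange_big /=; apply: eq_bigr => e _.
by rewrite card_fset_sum1 big_fset /= [RHS]big_mkcond.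
Qed.

Lemma sum_star_edges k (A : {fset graph T}) :
  (forall S, S \in A -> is_star k S) ->
  \sum_(S <- A) #|` edges S| = #|` A| * k.
Proof.
move=> stars; rewrite big_seq (eq_bigr (fun=> k)) => [|S /stars/star_hub[] //].
by rewrite -big_seq big_const_seq count_predT iter_addn_0 mulnC.
Qed.

Lemma star_decomposition_card k H B n :
  is_complete n H -> star_decomposition k H B -> #|` B| * k = 'C(n, 2).
Proof.
move=> Hc [stars once]; rewrite -(card_complete Hc).
rewrite -(@sum_star_edges k) => [|S /stars[]//].
rewrite (@sum_card_edges _ (edges H)) => [|S /stars[_ []]//].
rewrite big_seq (eq_bigr (fun=> 1)) => [|e /once //].
by rewrite -big_seq -card_fset_sum1.
Qed.

Lemma partial_decomposition_card k G A n :
  is_complete n G -> partial_star_decomposition k G A ->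
  'C(n, 2) <= #|` A| * k + #|` edges (leave G A)|.
Proof.
move=> Gc [stars _]; rewrite -(card_complete Gc).
rewrite -(@sum_star_edges k) => [|S /stars[]//].
rewrite (@sum_card_edges _ (edges G)) => [|S /stars[_ []]//].
rewrite [X in _ <= _ + X]card_fset_sum1 /edges /= big_fset /=.
rewrite [X in _ <= _ + X]big_mkcond /=.
rewrite -big_split card_fset_sum1 /=; apply: leq_sum => e _.
by rewrite -cardfs_eq0; case: eqP => [_|/eqP]; rewrite ?addn1 // addn0 lt0n.
Qed.

Lemma card_bigfcup_le (I : Type) (E : choiceType) (r : seq I) (F : I -> {fset E}) :
  #|` \bigcup_(i <- r) F i| <= \sum_(i <- r) #|` F i|.
Proof.
elim/big_ind2: _ => [|X m Y n Xm Yn|//]; first by rewrite cardfs0.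
by apply: leq_trans (leq_add Xm Yn); rewrite cardfsU leq_subr.
Qed.

Lemma disjoint_cliques_card m C L :
  (forall K, K \in C -> is_complete m K) -> is_disjoint_union C L ->
  #|` edges L| <= #|` C| * 'C(m, 2).
Proof.
move=> Cc [_ _ ->]; apply: leq_trans (card_bigfcup_le _ _) _.
rewrite big_seq (eq_bigr (fun=> 'C(m, 2))) => [|K /Cc/card_complete //].
by rewrite -big_seq big_const_seq count_predT iter_addn_0 mulnC.
Qed.

(** Here [C] is the set of cliques of the leave.  Let [Y] be the set of centres of
    stars of [B] outside [A], and [Z] the set of other vertices of [H].  An edge
    with both ends in [Z] has no end in [Y], so it lies in a star of [A].  If
    [Z] has a vertex outside [G], no such edge can reach it and [Z] is a
    singleton; otherwise each clique contains at most one vertex of [Z], because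
    its edges lie in no star of [A]. *)
Lemma embedding_card k m N G A H B C :
  0 < #|` C| -> (forall K, K \in C -> is_complete m K) ->
  is_disjoint_union C (leave G A) ->
  (forall S, S \in A -> subgraph S G) ->
  is_complete N H -> star_decomposition k H B -> A `<=` B ->
  #|` A| + N <= #|` B| + #|` C|.
Proof.
move=> C_gt0 Cc [_ vL eL] AG [cardH Hcomp] [stars once] sAB.
have cardAB := fsubset_leq_card sAB.
have [V0|/fset0Pn[x0 _]] := eqVneq (vertices H) fset0.
  by move: cardH; rewrite /graph_order V0 cardfs0 => <-; lia.
pose hub S := head x0 [seq v <- vertices S | all (fun e => v \in e) (edges S)].
have hubP S e : S \in B -> e \in edges S -> hub S \in e.
  move=> /stars[/star_hub[_ [c cS ce] _]] eS; rewrite /hub.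
  set s := filter _ _.
  have : c \in s by rewrite mem_filter cS andbT; apply/allP.
  have /allP : all (fun v => v \in e) s.
    by apply/allP => v; rewrite mem_filter => /andP[/allP/(_ _ eS)].
  by case: s => //= v s /(_ v); rewrite inE eqxx => ->.
pose Y := [fset hub S | S in B `\` A].
have cardY : #|` Y| + #|` A| <= #|` B|.
  have : #|` Y| <= #|` B `\` A| by apply: leq_imfset_card.
  by rewrite cardfsDS // leq_subRL // addnC.
pose Z := vertices H `\` Y.
have cardZ : N <= #|` Z| + #|` Y|.
  have := cardfsD (vertices H) Y; rewrite -/Z -/(graph_order H) cardH.
  by have := fsubset_leq_card (fsubsetIr (vertices H) Y); lia.
suff : #|` Z| <= #|` C| by lia.
have Zedge x y : x \in Z -> y \in Z -> x != y ->
    exists2 S, S \in A & [fset x; y] \in edges S.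
  rewrite !in_fsetD => /andP[xY xH] /andP[yY yH] xy.
  have /cardfs1P[S defS] : #|` containing B [fset x; y]| == 1.
    by apply/eqP/once/Hcomp.
  have : S \in containing B [fset x; y] by rewrite defS inE.
  rewrite !inE /= => /andP[SB eS]; exists S => //.
  apply: contraT => SA.
  have : hub S \in Y by apply: in_imfset; rewrite /= in_fsetD SA SB.
  by have := hubP _ _ SB eS; rewrite !inE => /orP[]/eqP->; apply: contraLR.
have [/fsubsetP ZG|/fsubsetPn[z zZ zG]] := boolP (Z `<=` vertices G); last first.
  suff /fsubset_leq_card : Z `<=` [fset z] by rewrite cardfs1; lia.
  apply/fsubsetP => x xZ; rewrite inE; apply: contraT => xz.
  have [S SA eS] := Zedge x z xZ zZ xz.
  have /fsubsetP/(_ z) := edge_sub eS; rewrite !inE eqxx orbT => /(_ isT).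
  by have [/fsubsetP vS _] := AG _ SA; move=> /vS; rewrite (negbTE zG).
pose clique z := head (leave G A) [seq K <- C | z \in vertices K].
have cliqueP z : z \in Z -> clique z \in C /\ z \in vertices (clique z).
  move=> /ZG; change (vertices G) with (vertices (leave G A)).
  rewrite vL => /bigfcupP[K /andP[KC _] zK]; rewrite /clique.
  set s := filter _ _.
  have : K \in s by rewrite mem_filter zK.
  have /allP : all (fun K => (K \in C) && (z \in vertices K)) s.
    by apply/allP => K'; rewrite mem_filter andbC.
  by case: s => //= K' s /(_ K'); rewrite inE eqxx => /(_ isT)/andP.
have <- : #|` [fset clique z | z in Z]| = #|` Z|.
  apply: card_in_imfset => x y /= xZ yZ E; apply: contraTeq isT => xy.
  have [xC xK] := cliqueP _ xZ; have [_ yK] := cliqueP _ yZ.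
  have xyL : [fset x; y] \in edges (leave G A).
    rewrite eL; apply/bigfcupP; exists (clique x); rewrite ?xC //.
    by apply: (Cc _ xC).2; rewrite // E.
  have [S SA eS] := Zedge x y xZ yZ xy.
  move: xyL; rewrite !inE /= => /andP[_ /eqP/fsetP/(_ S)].
  by rewrite !inE /= SA eS.
apply/fsubset_leq_card/fsubsetP => K /imfsetP[z /= zZ ->].
by have [] := cliqueP _ zZ.
Qed.

End StarCounting.
(** * Arithmetic *)

Section Arithmetic.
Import Order.TTheory GRing.Theory Num.Theory.

Lemma sqr_of_nat_sqrt (R : rcfType) (k m : nat) :
  (m%:R = Num.sqrt (2 * k%:R) :> R)%R -> m ^ 2 = 2 * k.
Proof.
move=> m_def; apply/eqP; rewrite -(@eqr_nat R) natrX m_def sqr_sqrtr ?natrM //.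
by rewrite mulr_ge0 ?ler0n.
Qed.

(** After subtracting [sqrt (2 k) = m], both sides of the order condition are
    nonnegative and can be squared; a common factor [m ^ 2] then cancels. *)
Lemma order_condition_mul (R : rcfType) (k m r : nat) : 0 < m ->
  (m%:R = Num.sqrt (2 * k%:R) :> R)%R ->
  order_condition R k m (r.+1 * m)%N%:Z <-> 2 * m ^ 2 + 2 < r ^ 2.
Proof.
move=> m_gt0 m_def; have m2 := sqr_of_nat_sqrt m_def.
have nat_arg : (k%:R * (2 * k%:R + 1) = (k * (2 * k + 1))%N%:R :> R)%R.
  by rewrite natrM natrD natrM.
pose y : R := (2 * Num.sqrt (k * (2 * k + 1))%N%:R)%R.
have y2 : (y ^+ 2 = (m ^ 2 * (2 * m ^ 2 + 2))%N%:R)%R.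
  rewrite exprMn sqr_sqrtr ?ler0n // -natrX -natrM; congr (_%:R)%R.
  by rewrite m2; lia.
have y_lt : ((2 * Num.sqrt (k%:R * (2 * k%:R + 1)) + Num.sqrt (2 * k%:R)
              < (r.+1 * m)%N%:Z%:~R :> R) = (2 * m ^ 2 + 2 < r ^ 2)%N)%R.
  rewrite nat_arg -m_def -/y -pmulrn mulSn natrD addrC ltrD2l.
  rewrite -ltr_sqr ?nnegrE ?ler0n ?mulr_ge0 ?sqrtr_ge0 // y2 -natrX ltr_nat.
  by rewrite expnMn [r ^ 2 * _]mulnC ltn_pmul2l ?expn_gt0 ?m_gt0.
rewrite /order_condition y_lt; split=> [[]//|->]; split=> //.
by rewrite PoszM intdiv.modzMl mod0z.
Qed.

Lemma least_order (R : rcfType) (k m n : nat) : 0 < k ->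
  (m%:R = Num.sqrt (2 * k%:R) :> R)%R -> order_condition R k m n%:Z ->
  (forall j : int, order_condition R k m j -> (n%:Z <= j)%R) ->
  exists r, [/\ n = r.+1 * m, m ^ 2 = 2 * k, 2 * m ^ 2 + 2 < r ^ 2
    & r.-1 ^ 2 <= 2 * m ^ 2 + 2].
Proof.
move=> k_gt0 m_def n_cond n_min; have m2 := sqr_of_nat_sqrt m_def.
have m_gt0 : 0 < m by case: (m) m2 => //; lia.
have [q def_n] : exists q, n = q * m.
  by have [] := n_cond; rewrite mod0z => /dvdz_mod0P n_dvd _; apply/dvdnP.
case: q => [|r] in def_n.
  have [_] := n_cond; rewrite def_n mul0n => /lt_geF; rewrite addr_ge0 //.
    by rewrite mulr_ge0 ?ler0n ?sqrtr_ge0.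
  by rewrite sqrtr_ge0.
exists r; split=> //.
  by apply/(order_condition_mul r m_gt0 m_def); rewrite -def_n.
rewrite leqNgt; apply/negP; case: r def_n => [|r] def_n //= r_big.
have := n_min _ ((order_condition_mul r m_gt0 m_def).2 r_big).
by rewrite def_n lez_nat leq_pmul2r // ltnn.
Qed.

Lemma dvdn_consecutive_2exp u N :
  2 ^ u %| N * N.-1 -> (2 ^ u %| N) || (2 ^ u %| N.-1).
Proof.
case: N => [|N] /=; first by rewrite dvdn0.
have [oddN|evenN] := boolP (odd N).
  by rewrite Gauss_dvdl ?coprimeXl ?coprime2n // => ->.
by rewrite Gauss_dvdr ?coprimeXl ?coprime2n //= => ->; rewrite orbT.
Qed.

(** With [q = r + 1], the edge count gives [a >= q (q - 1)], so that
    [b >= r ^ 2 - 1 + N >= 4 k + 2 + N].  On the other hand [2 k b = N (N - 1)]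
    forces [N = 2 k c] or [N = 2 k c + 1], and [b] is [c (N - 1)] or [c N].
    For [c <= 2] this is at most [N + 4 k + 1]: the case
    [c = 2], [N = 4 k + 1] misses the lower bound by exactly one. *)
Lemma too_many_stars t k m r N a b : k = 2 ^ t -> m ^ 2 = 2 * k ->
  2 * m ^ 2 + 2 < r ^ 2 -> N < 6 * k ->
  b * k = 'C(N, 2) -> 'C(r.+1 * m, 2) <= a * k + r.+1 * 'C(m, 2) ->
  a + N <= b + r.+1 -> False.
Proof.
move=> def_k m2 r_big N_lt bk ak ab.
have k_gt0 : 0 < k by rewrite def_k expn_gt0.
have bin2M n : 'C(n, 2) * 2 = n * n.-1.
  by rewrite bin2 muln2 halfK; case: n => //= n; rewrite oddM /= andNb subn0.
have a_ge : r.+1 * r <= a.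
  rewrite -(leq_pmul2r k_gt0) -(leq_pmul2r (isT : 0 < 2)).
  have := bin2M (r.+1 * m); have := bin2M m.
  case: m m2 {r_big} ak => [|m] /=; first by move: k_gt0; lia.
  rewrite -mulnn; nia.
have r2 : 4 * k + 3 <= r ^ 2 by lia.
have b_ge : 4 * k + 2 + N <= b by rewrite -mulnn in r2; lia.
have Nb : b * (2 * k) = N * N.-1 by rewrite -bin2M -bk; lia.
have : 2 ^ t.+1 %| N * N.-1 by rewrite -Nb expnS -def_k dvdn_mull.
move/dvdn_consecutive_2exp; rewrite expnS -def_k => /orP[] /dvdnP[c def_N].
  have c_lt : c < 3 by rewrite -(ltn_pmul2r k_gt0); lia.
  have : b <= c * N.-1.
    by rewrite -(leq_pmul2r (_ : 0 < 2 * k)) ?muln_gt0 // Nb {1}def_N mulnAC.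
  move: c_lt def_N b_ge; case: c => [|[|[|//]]] _ ->; lia.
case: N N_lt def_N {bk ab} b_ge Nb => [|N] /= N_lt def_N b_ge Nb.
  by move/eqP: Nb; rewrite !muln_eq0; lia.
have c_lt : c < 3 by rewrite -(ltn_pmul2r k_gt0); lia.
have : b <= c * N.+1.
  rewrite -(leq_pmul2r (_ : 0 < 2 * k)) ?muln_gt0 // Nb.
  by rewrite [X in _ * X <= _]def_N mulnCA mulnA.
by move: c_lt def_N b_ge; case: c => [|[|[|//]]] _ ->; lia.
Qed.

Lemma square_gap m r :
  3 < m -> 2 * m ^ 2 + 2 < r ^ 2 -> r.-1 ^ 2 <= 2 * m ^ 2 + 2 ->
  exists2 a, r = m + a & a <= m.
Proof.
move=> m_gt3 lo hi; exists (r - m).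
  rewrite subnKC //; rewrite -leq_sqr; lia.
have : r.-1 < m.*2.-1; last by lia.
rewrite -ltn_sqr; apply: (leq_ltn_trans hi).
by case: m m_gt3 {lo hi} => // m; nia.
Qed.

End Arithmetic.
(** * The leave as a union of cliques *)

Section CliqueCoordinates.
Local Open Scope fset_scope.
Variable T : choiceType.
Implicit Types (G K L : graph T) (C : {fset graph T}).

Fact complete_wf (V : {fset T}) :
  wf_graph (V, [fset e in fpowerset V | #|` e| == 2]).
Proof. by apply/allP => e; rewrite !inE /= fpowersetE. Qed.

Definition complete_graph V := Graph (complete_wf V).

Lemma complete_graphP V : is_complete #|` V| (complete_graph V).
Proof.
split=> // x y xV yV xy; rewrite /edges !inE /= fpowersetE cardfs2 xy eqxx andbT.
by apply/fsubsetP => z; rewrite !inE => /orP[]/eqP->.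
Qed.

(** The vertices of a disjoint union of [q] cliques of size [m] are named by
    pairs (clique, position in the clique), so that the complement of the union
    becomes [multipartite]. *)
Lemma clique_coordinates m q C L : 0 < graph_order L ->
  #|` C| = q -> (forall K, K \in C -> is_complete m K) -> is_disjoint_union C L ->
  exists phi : 'I_q * 'I_m -> T,
    [/\ injective phi, forall x, phi x \in vertices L,
        forall v, v \in vertices L -> exists x, v = phi x
      & forall x y, x != y ->
          ([fset phi x; phi y] \in edges L) = ~~ multipartite x y].
Proof.
rewrite /graph_order cardfs_gt0 => /fset0Pn[x0 _] cardC Cc [disj vL eL].
pose K (i : 'I_q) := nth L C i.
have KC i : K i \in C by rewrite mem_nth // cardC.
pose phi (x : 'I_q * 'I_m) := nth x0 (vertices (K x.1)) x.2.
have cardK i : #|` vertices (K i)| = m by have [] := Cc _ (KC i).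
have phiK x : phi x \in vertices (K x.1) by rewrite mem_nth // cardK.
have same_clique i x : phi x \in vertices (K i) -> x.1 = i.
  move=> xi; apply/val_inj/eqP.
  rewrite -(nth_uniq L _ _ (fset_uniq C)) ?cardC ?ltn_ord //.
  apply: contraTT xi => /(disj _ _ (KC x.1) (KC i)) /fdisjointP.
  exact.
have phi_inj : injective phi.
  move=> x y E.
  have xy1 : x.1 = y.1 by have := phiK x; rewrite E => /same_clique.
  apply/eqP; rewrite -pair_eqE /pair_eq xy1 eqxx -val_eqE /=.
  rewrite -(nth_uniq x0 _ _ (fset_uniq (vertices (K y.1)))) ?cardK ?ltn_ord //.
  by move: E; rewrite /phi xy1 => ->.
exists phi; split=> //.
- move=> x; rewrite vL; apply/bigfcupP; exists (K x.1); rewrite ?KC //.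
- move=> v; rewrite vL => /bigfcupP[K' /andP[K'C _] vK'].
  have iq : index K' C < q by rewrite -cardC index_mem.
  have def_K' : K (Ordinal iq) = K' by rewrite /K nth_index.
  rewrite -def_K' in vK'.
  have jm : index v (vertices (K (Ordinal iq))) < m.
    by rewrite -(cardK (Ordinal iq)) index_mem.
  by exists (Ordinal iq, Ordinal jm); rewrite /phi /= nth_index.
move=> x y xy; rewrite /multipartite negbK eL.
apply/bigfcupP/eqP => [[K' /andP[K'C _] eK']|xy1].
  have iq : index K' C < q by rewrite -cardC index_mem.
  have def_K' : K (Ordinal iq) = K' by rewrite /K nth_index.
  have /fsubsetP sub := edge_sub eK'.
  rewrite -def_K' in sub; rewrite (same_clique (Ordinal iq) x).
    by rewrite (same_clique (Ordinal iq) y) ?sub ?inE ?eqxx ?orbT.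
  by rewrite sub ?inE ?eqxx.
exists (K x.1); first by rewrite KC.
apply: (Cc _ (KC _)).2; rewrite ?phiK //; first by rewrite xy1 phiK.
by rewrite (inj_eq phi_inj).
Qed.

Lemma multipartite_star_decomposition k m q a C L :
  0 < k -> m ^ 2 = 2 * k -> a <= m -> q.-1 = (m + a)%N -> 0 < graph_order L ->
  #|` C| = q -> (forall K, K \in C -> is_complete m K) -> is_disjoint_union C L ->
  exists (G : graph T) (A : {fset graph T}),
    [/\ is_complete (graph_order L) G, partial_star_decomposition k G A
      & leave G A = L].
Proof.
move=> k_gt0 m2 am q1 L_gt0 cardC Cc LC.
have [phi [phi_inj phiV phi_onto phiE]] := clique_coordinates L_gt0 cardC Cc LC.
have [o [oe deg_o]] := multipartite_orientation m2 am q1.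
have [G [Gc vG]] :
    exists G, is_complete (graph_order L) G /\ vertices G = vertices L.
  by exists (complete_graph (vertices L)); split=> //; apply: complete_graphP.
rewrite -vG in phiV phi_onto.
have phiG x y : x != y -> [fset phi x; phi y] \in edges G.
  by move=> xy; apply: Gc.2; rewrite ?phiV // (inj_eq phi_inj).
have k_dvd x : k %| outdeg o x.
  by rewrite deg_o /two_star_weights; case: ifP => _; rewrite ?dvdn_mull.
have phi_edge x y : multipartite x y -> [fset phi x; phi y] \in edges G.
  by rewrite /multipartite => xy; apply: phiG; apply: contraNneq xy => ->.
have [A [stars cover]] :=
  stars_of_orientation phi_inj k_gt0 oe k_dvd phiV phi_edge.
exists G, A.
have edgeGP e : e \in edges G -> exists x y, x != y /\ e = [fset phi x; phi y].
  move=> /edgeP[_ [_ [/phi_onto[x ->] /phi_onto[y ->] xy ->]]].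
  by exists x, y; split=> //; apply: contraNneq xy => ->.
split=> //.
  by split=> // e /edgeGP[x [y [_ ->]]]; rewrite cover leq_b1.
apply: val_inj; rewrite /= /leave_val vG [val L]surjective_pairing; congr (_, _).
apply/fsetP => e; rewrite !inE /=; apply/andP/idP => [[eG]|eL].
  have [x [y [xy ->]]] := edgeGP _ eG.
  by rewrite -cardfs_eq0 cover phiE // eqb0.
have eG : e \in edges G.
  by have [x [y [xV yV xy ->]]] := edgeP eL; apply: Gc.2; rewrite ?vG.
split=> //; move: eL; have [x [y [xy ->]]] := edgeGP _ eG.
by rewrite phiE // -cardfs_eq0 cover eqb0.
Qed.

End CliqueCoordinates.

Theorem lemma18 (R : rcfType) (T : choiceType) (t k m n : nat) (L : graph T)
  (t_odd : odd t) (t_ge3 : (3 <= t)%N) (k_def : k = (2 ^ t)%N)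
  (m_def : (m%:R = Num.sqrt (2 * k%:R) :> R)%R)
  (n_cond : order_condition R k m n%:Z)
  (n_min : forall j : int, order_condition R k m j -> (n%:Z <= j)%R)
  (L_order : graph_order L = n)
  (L_union : exists C : {fset graph T},
     [/\ #|` C|%fset = (n %/ m)%N,
         forall K : graph T, K \in C -> is_complete m K
       & is_disjoint_union C L]) :
  (exists (G : graph T) (A : {fset graph T}),
     [/\ is_complete n G, partial_star_decomposition k G A & leave G A = L]) /\
  (forall (G : graph T) (A : {fset graph T}),
     is_complete n G -> partial_star_decomposition k G A -> leave G A = L ->
     forall s : nat, (s < 6 * k - n)%N ->
       ~ exists (H : graph T) (B : {fset graph T}),
           [/\ is_complete (n + s) H, star_decomposition k H B
             & is_embedding k G A H B]).
Proof.
have k_ge8 : 2 ^ 3 <= k by rewrite k_def leq_exp2l.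
have k_gt0 : 0 < k by apply: leq_trans k_ge8.
have [r [def_n m2 r_big r_small]] := least_order k_gt0 m_def n_cond n_min.
have m_gt3 : 3 < m.
  rewrite -ltn_sqr m2; apply: leq_trans (_ : 2 * 2 ^ 3 <= _) => //.
  by rewrite leq_mul2l.
have [C [cardC Cc LC]] := L_union.
have {}cardC : #|` C|%fset = r.+1.
  by rewrite cardC def_n mulnK //; apply: leq_trans m_gt3.
split.
  have [a def_r am] := square_gap m_gt3 r_big r_small.
  have [||G [A [Gc decA leaveA]]] :=
    multipartite_star_decomposition k_gt0 m2 am _ _ cardC Cc LC.
  - by rewrite -def_r.
  - by rewrite L_order def_n muln_gt0 (leq_trans _ m_gt3).
  by exists G, A; rewrite -L_order.
move=> G A Gc decA leaveA s s_lt [H [B [Hc decB [_ sAB _]]]].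
have ns_lt : (n + s < 6 * k) by lia.
rewrite -leaveA in LC.
apply: (too_many_stars k_def m2 r_big ns_lt (star_decomposition_card Hc decB)
  (a := #|` A|%fset)).
  rewrite -def_n -cardC.
  apply: leq_trans (partial_decomposition_card Gc decA) _.
  by rewrite leq_add2l disjoint_cliques_card.
rewrite -cardC; apply: (embedding_card _ Cc LC _ Hc decB sAB); first by rewrite cardC.
by move=> S SA; have [/(_ _ SA)[]] := decA.
Qed.
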